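(* Let $F(x)=f(x)+\delta_{\mathcal M}(x)$ on $\mathbb{R}^n$ and $\widetilde F(x,u)=\Psi^*(-u)+\langle u,|Y^Tx|\rangle+\delta_{\mathcal M}(x)$ on $\mathbb{R}^n\times\mathbb{R}^p$. Suppose that $\widetilde F$ is a KL function with exponent $\alpha\in[0,1)$. Then $F$ is a KL function with exponent $\alpha$.
   Context: Setting. $Y\in\mathbb{R}^{n\times p}$; $\phi:\mathbb{R}_+\to\mathbb{R}_+$ is a continuous concave function with $\phi(0)=0$, differentiable on $(0,\infty)$, such that the limit $\ell:=\lim_{s\downarrow0}\phi'(s)$ exists (in $\mathbb{R}$). $|y|$ is the vector of entrywise absolute values. $f(x)=\sum_{i=1}^p\phi(|[Y^Tx]_i|)$, $\mathcal M=\{u\in\mathbb{R}^n:\|u\|=1\}$ (Euclidean norm), $\delta_{\mathcal M}$ is the indicator function of $\mathcal M$ ($0$ on $\mathcal M$, $+\infty$ elsewhere). The function $\Psi$. $\psi:\mathbb{R}\to\mathbb{R}$ is the convex function $\psi(s)=-\phi(s)$ for $s\ge0$ and $\psi(s)=s^2-\ell s$ for $s<0$; $\Psi(y)=\sum_{i=1}^p\psi(y_i)$, and $\Psi^*(w)=\sum_{i=1}^p\psi^*(w_i)$ with $\psi^*(w)=\sup_s\{ws-\psi(s)\}$ the Fenchel conjugate. Subdifferentials. For a proper closed $h:\mathbb{R}^m\to(-\infty,\infty]$ and $\bar x\in\mathrm{dom}\,h$, the regular subdifferential is $\widehat\partial h(\bar x)=\{v:\liminf_{x\to\bar x,x\ne\bar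 x}\frac{h(x)-h(\bar x)-\langle v,x-\bar x\rangle}{\|x-\bar x\|}\ge0\}$ and the limiting subdifferential is $\partial h(\bar x)=\{v:\exists x^k\to\bar x,\ h(x^k)\to h(\bar x),\ v^k\in\widehat\partial h(x^k),\ v^k\to v\}$; both are empty outside $\mathrm{dom}\,h$; $\mathrm{dom}\,\partial h=\{x:\partial h(x)\ne\emptyset\}$. KL exponent. A proper closed $h$ satisfies the KL property at $\hat x\in\mathrm{dom}\,\partial h$ with exponent $\alpha\in[0,1)$ if there are $a\in(0,\infty]$, $a_0>0$ and a neighborhood $V$ of $\hat x$ such that, with $\varphi(\nu)=a_0\nu^{1-\alpha}$, one has $\varphi'(h(x)-h(\hat x))\,\mathrm{dist}(0,\partial h(x))\ge1$ for all $x\in V$ with $h(\hat x)<h(x)<h(\hat x)+a$ (where the distance to the empty set is $+\infty$). $h$ is a KL function with exponent $\alpha$ if this holds at every $\hat x\in\mathrm{dom}\,\partial h$. *)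

(* Defs.v *)
From mathcomp Require Import all_boot all_order all_algebra.
From mathcomp Require Import all_classical all_reals all_analysis.

Set Implicit Arguments.
Unset Strict Implicit.
Unset Printing Implicit Defensive.

Import Order.TTheory GRing.Theory Num.Theory numFieldNormedType.Exports.

Local Open Scope classical_set_scope.
Local Open Scope ring_scope.

(* The library norm on matrices is the sup norm, which induces the Euclidean
   topology; only the norm and the inner product have to be redefined. *)
Definition dotv (R : realType) (m : nat) (u v : 'cV[R]_m) : R :=
  \sum_(i < m) u i 0 * v i 0.

Definition enorm (R : realType) (m : nat) (u : 'cV[R]_m) : R :=
  Num.sqrt (dotv u u).

Definition absv (R : realType) (m : nat) (y : 'cV[R]_m) : 'cV[R]_m :=
  map_mx Num.norm y.

Definition unit_sphere (R : realType) (n : nat) : set 'cV[R]_n :=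
  [set u | enorm u = 1].
Arguments unit_sphere {R} n.

Section Subdifferential.
Context (R : realType) (m : nat).
Implicit Types (h : 'cV[R]_m -> \bar R) (x v : 'cV[R]_m).

Local Open Scope ereal_scope.

Definition indicator_fun (A : set 'cV[R]_m) (x : 'cV[R]_m) : \bar R :=
  if x \in A then 0 else +oo.

Definition edom h : set 'cV[R]_m := [set x | h x < +oo].

Definition proper_fun h : Prop := (forall x, -oo < h x) /\ edom h !=set0.

(* [x^'] is the filter of punctured neighbourhoods of [x]. *)
Definition regular_subdiff h x : set 'cV[R]_m :=
  [set v | edom h x /\
    0 <= limf_einf
      (fun y => (h y - h x - (dotv v (y - x)%R)%:E) * ((enorm (y - x)%R)^-1)%:E)
      x^'].

Definition limiting_subdiff h x : set 'cV[R]_m :=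
  [set v | edom h x /\
    exists (x_ v_ : nat -> 'cV[R]_m),
      [/\ x_ k @[k --> \oo] --> x,
          h (x_ k) @[k --> \oo] --> h x,
          (forall k, regular_subdiff h (x_ k) (v_ k)) &
          v_ k @[k --> \oo] --> v]].

Definition dom_subdiff h : set 'cV[R]_m :=
  [set x | limiting_subdiff h x !=set0].

(* [ereal_inf set0 = +oo] gives the convention for the empty set. *)
Definition dist0 (A : set 'cV[R]_m) : \bar R :=
  ereal_inf [set (enorm v)%:E | v in A].

Definition desing (a0 alpha : R) (nu : R) : R := (a0 * nu `^ (1 - alpha))%R.

(* For proper [h] and [xhat] in [dom_subdiff h], the bounds on [h x] force
   [h x - h xhat] to be a positive real, so [fine] loses nothing. *)
Definition KL_at h (alpha : R) (xhat : 'cV[R]_m) : Prop :=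
  exists (a : \bar R) (a0 : R) (V : set 'cV[R]_m),
    [/\ 0 < a, (0 < a0)%R, nbhs xhat V &
      forall x, V x -> h xhat < h x -> h x < h xhat + a ->
        1 <= (derive1 (desing a0 alpha) (fine (h x - h xhat)))%:E
             * dist0 (limiting_subdiff h x)].

(* Closed means lower semicontinuous. *)
Definition KL_function h (alpha : R) : Prop :=
  [/\ proper_fun h, lower_semicontinuous h &
      forall xhat, dom_subdiff h xhat -> KL_at h alpha xhat].

End Subdifferential.

Section Model.
Context (R : realType).

Definition concave_on (D : set R) (g : R -> R) : Prop :=
  @convex_function R R^o D (fun s => - g s).

Definition fenchel_conj (g : R -> R) (w : R) : \bar R :=
  ereal_sup [set (w * s - g s)%:E | s in setT].

Definition psi (phi : R -> R) (ell : R) (s : R) : R :=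
  if 0 <= s then - phi s else s ^+ 2 - ell * s.

Definition Psi_conj (phi : R -> R) (ell : R) (p : nat) (w : 'cV[R]_p) : \bar R :=
  (\sum_(i < p) fenchel_conj (psi phi ell) (w i ord0))%E.

Definition f_obj (phi : R -> R) (n p : nat) (Y : 'M[R]_(n, p)) (x : 'cV[R]_n) : R :=
  \sum_(i < p) phi `|(Y^T *m x) i 0|.

Definition F_obj (phi : R -> R) (n p : nat) (Y : 'M[R]_(n, p))
    (x : 'cV[R]_n) : \bar R :=
  ((f_obj phi Y x)%:E + indicator_fun (unit_sphere n) x)%E.

(* A point of R^n x R^p is a stacked vector [col_mx x u : 'cV_(n + p)], so that
   [enorm] is the Euclidean norm of the product. *)
Definition Ftilde (phi : R -> R) (ell : R) (n p : nat) (Y : 'M[R]_(n, p))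
    (z : 'cV[R]_(n + p)) : \bar R :=
  let x := usubmx z in
  let u := dsubmx z in
  (Psi_conj phi ell (- u)%R + (dotv u (absv (Y^T *m x)))%:E
   + indicator_fun (unit_sphere n) x)%E.

End Model.

(* Main.v *)
Require Import Defs.
From mathcomp Require Import all_boot all_order all_algebra.
From mathcomp Require Import all_classical all_reals all_analysis.
From mathcomp Require Import ring lra.

Set Implicit Arguments.
Unset Strict Implicit.
Unset Printing Implicit Defensive.

Import Order.TTheory GRing.Theory Num.Theory numFieldNormedType.Exports.
Local Open Scope classical_set_scope.
Local Open Scope ring_scope.

(** The function [F] is the partial minimum of [Ftilde] over its second
    variable.  Indeed the infimum over [u] of [Psi^*(-u) + <u, y>] is
    [- Psi^**(y) = - Psi(y)], which for [y = |Y^T x|] is [f x].  Since [psi] is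
    convex and differentiable, the minimizer is unique and explicit:
    [u = - Psi'(y)], with entries [phi'(y_i)], where [phi'(0)] is read as [ell].
    Call it [sigma x] ([slopes] below).  It depends continuously on [x] because
    the derivative of a differentiable concave function is continuous, and [ell]
    is by assumption its limit at [0].

    Everything else is a general fact about partial minimization with a
    continuous exact selection [sigma].  If [v] is a regular subgradient of [h] at
    [x], then [(v, 0)] is one of [H] at [(x, sigma x)]: [H] lies above [h], with
    equality on the graph of [sigma], and passing from [x' - x] to the longer
    vector [(x', u') - (x, sigma x)] only enlarges the error term.  Continuity of
    [sigma] lets this pass to limits ([limiting_subdiff_graph]).  Hence the
    graph sends the domain of the limiting subdifferential of [h] into that of
    [H], it preserves values, and the distance of [0] to the subdifferential is
    no larger at [(x, sigma x)] than at [x]; a KL inequality for [H] at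
    [(x, sigma x)] is therefore, along the graph, a KL inequality for [h] at [x],
    with the same constants and the same exponent
    ([KL_function_partial_min]).

    On the scalar side, [fenchel_young] gives [F <= Ftilde], and
    [fenchel_conj_slope] gives equality at [sigma x], from the
    supergradient inequality [slope_supergradient].  Lower semicontinuity of [F]
    comes from the continuity of [f] and the closedness of the sphere. *)

(** * Euclidean structure of stacked vectors *)

Section Euclidean.
Context {R : realType}.

Lemma dotv_ge0 {m : nat} (u : 'cV[R]_m) : 0 <= dotv u u.
Proof. by apply: sumr_ge0 => i _; rewrite -expr2 sqr_ge0. Qed.

Lemma enorm_gt0 {m : nat} (u : 'cV[R]_m) : u != 0 -> 0 < enorm u.
Proof.
move=> u0; rewrite sqrtr_gt0 lt_def dotv_ge0 andbT.
apply: contra u0; rewrite psumr_eq0; last by move=> i _; rewrite -expr2 sqr_ge0.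
move=> /allP uu; apply/eqP/colP => i; rewrite mxE.
by have := uu i (mem_index_enum i); rewrite mulf_eq0 orbb => /eqP.
Qed.

Lemma dotv_col_mx {n p : nat} (a c : 'cV[R]_n) (b d : 'cV[R]_p) :
  dotv (col_mx a b) (col_mx c d) = dotv a c + dotv b d.
Proof.
rewrite /dotv big_split_ord/=.
by congr (_ + _); apply: eq_bigr => i _; rewrite ?col_mxEu ?col_mxEd.
Qed.

Lemma dot0v {m : nat} (u : 'cV[R]_m) : dotv 0 u = 0.
Proof. by rewrite /dotv big1// => i _; rewrite mxE mul0r. Qed.

Lemma dotv0 {m : nat} (u : 'cV[R]_m) : dotv u 0 = 0.
Proof. by rewrite /dotv big1// => i _; rewrite mxE mulr0. Qed.

Lemma enorm_col_mx0 {n p : nat} (a : 'cV[R]_n) :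
  enorm (col_mx a (0 : 'cV[R]_p)) = enorm a.
Proof. by rewrite /enorm dotv_col_mx dot0v addr0. Qed.

Lemma enorm_usubmx_le {n p : nat} (z : 'cV[R]_(n + p)) :
  enorm (usubmx z) <= enorm z.
Proof.
by rewrite ler_wsqrtr// -[z in leRHS]vsubmxK dotv_col_mx lerDl dotv_ge0.
Qed.

Lemma continuous_usubmx {n p : nat} :
  continuous (usubmx : 'cV[R]_(n + p) -> 'cV[R]_n).
Proof.
move=> u A /nbhs_ballP[e /= e0 eA].
apply/nbhs_ballP; exists e => //= v [_ uv]; apply: eA; split => // i j.
by apply: (le_lt_trans _ (uv (lshift p i) j)); rewrite !mxE.
Qed.

(** The topology of matrices is the product topology, so that convergence can be
    tested entry by entry. *)
Lemma cvg_mx {T : Type} {F : set_system T} {FF : Filter F} {n p : nat}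
    (f : T -> 'M[R]_(n, p)) (M : 'M[R]_(n, p)) :
  (forall i j, f x i j @[x --> F] --> M i j) -> f @ F --> M.
Proof.
move=> fM A [P MP PA].
have H : \forall x \near F, forall ij, P ij.1 ij.2 (f x ij.1 ij.2).
  by apply: filter_forall => -[i j]; apply: fM; exact: MP.
rewrite nbhs_filterE; apply: filterS H => x Px; apply: PA => i j.
exact: (Px (i, j)).
Qed.

End Euclidean.

(** * Regular subgradients *)

Section Regular.
Context {R : realType}.

Local Open Scope ereal_scope.

Lemma limf_einf_ge0P {X : topologicalType} {F : set_system X} {FF : Filter F}
    (g : X -> \bar R) :
  0 <= @limf_einf X X R g F <->
  forall e : R, (0 < e)%R -> \forall y \near F, (- e)%:E <= g y.
Proof.
rewrite limf_einfE; split=> [g0 e e0|ge].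
  have : (- e)%:E < ereal_sup [set ereal_inf (g @` V) | V in F].
    by apply: lt_le_trans g0; rewrite lte_fin oppr_lt0.
  move=> /ereal_sup_gt[_ [V FV <-] eV].
  apply: filterS FV => y Vy; apply: le_trans (ltW eV) _.
  by apply: ereal_inf_lbound; exists y.
apply/lee_addgt0Pr => e e0.
rewrite -leeBlDr// sub0e.
apply: le_trans (ereal_sup_ubound _); last first.
  by exists [set y | (- e)%:E <= g y]; [exact: ge|].
by apply: le_ereal_inf_tmp => _ [y /= ey <-].
Qed.

(** The definition by a quotient treats the base point apart and divides by the
    norm; in this affine form the base point needs no exclusion, and the
    inequality can be weakened term by term when the space is enlarged. *)
Lemma regular_subdiffP {m : nat} {h : 'cV[R]_m -> \bar R}
    {x v : 'cV[R]_m} {r : R} :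
  h x = r%:E ->
  regular_subdiff h x v <->
  forall e : R, (0 < e)%R -> \forall y \near x,
    (r + dotv v (y - x) - e * enorm (y - x))%:E <= h y.
Proof.
move=> hx.
have quotient (y : 'cV[R]_m) (e : R) : y != x ->
    ((- e)%:E <= (h y - h x - (dotv v (y - x)%R)%:E) * ((enorm (y - x)%R)^-1)%:E)
    = ((r + dotv v (y - x) - e * enorm (y - x))%:E <= h y).
  move=> yx; have N0 : (0 < enorm (y - x))%R by rewrite enorm_gt0// subr_eq0.
  rewrite lee_pdivlMr// -EFinM hx leeBrDr// leeBrDr// -!EFinD.
  by congr (_%:E <= _); ring.
rewrite /regular_subdiff /=.
split=> [[_ /limf_einf_ge0P ge] e e0|ge].
  have := ge e e0; rewrite near_withinE; apply: filterS => y hy.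
  have [->|yx] := eqVneq y x.
    by rewrite subrr /enorm !dotv0 sqrtr0 mulr0 subr0 addr0 hx.
  by rewrite -quotient//; exact: hy.
split; first by rewrite /edom /= hx ltry.
apply/limf_einf_ge0P => e e0; rewrite near_withinE.
by apply: filterS (ge e e0) => y hy yx; rewrite quotient.
Qed.

Lemma dist0_ge0 {m : nat} (A : set 'cV[R]_m) : 0 <= dist0 A.
Proof. by apply: le_ereal_inf_tmp => _ [v _ <-]; rewrite lee_fin sqrtr_ge0. Qed.

End Regular.

(** * Partial minimization with a continuous selection *)

Section PartialMinimization.
Context {R : realType} {n p : nat}.
Variables (H : 'cV[R]_(n + p) -> \bar R) (h : 'cV[R]_n -> \bar R).
Variable sigma : 'cV[R]_n -> 'cV[R]_p.
Hypothesis h_le : forall z, (h (usubmx z) <= H z)%E.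
Hypothesis sigma_min : forall x, H (col_mx x (sigma x)) = h x.
Hypothesis sigma_cont : continuous sigma.
Hypothesis h_fin : forall x, (-oo < h x)%E.

Let graph x := col_mx x (sigma x).

Lemma continuous_graph : continuous graph.
Proof.
move=> x; apply: (cvg_mx (F := nbhs x)) => i j; rewrite /graph.
case: (split_ordP i) => k ->.
  under eq_fun do rewrite col_mxEu.
  by rewrite col_mxEu; exact: coord_continuous.
under eq_fun do rewrite col_mxEd.
rewrite col_mxEd.
apply: (@continuous_comp _ _ _ sigma (fun M : 'cV[R]_p => M k j)).
  exact: sigma_cont.
exact: coord_continuous.
Qed.

(** Along [z = (x', u')], the bound [H z >= h x'] discards [u'], and the error
    [e * enorm (x' - x)] is at most [e * enorm (z - graph x)], while [(v, 0)] has
    the same scalar product with [z - graph x] as [v] has with [x' - x]. *)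
Lemma regular_subdiff_graph x v :
  regular_subdiff h x v -> regular_subdiff H (graph x) (col_mx v 0).
Proof.
move=> hv; have [hx _] := hv.
have hxE : h x = (fine (h x))%:E by rewrite fineK// fin_numElt h_fin.
have HxE : H (graph x) = (fine (h x))%:E by rewrite sigma_min.
move/(regular_subdiffP hxE) in hv; apply/(regular_subdiffP HxE) => e e0.
have xE : x = usubmx (graph x) by rewrite col_mxKu.
have cu : usubmx z @[z --> graph x] --> x.
  by rewrite [X in _ --> X]xE; exact: continuous_usubmx.
have := cu _ (hv e e0); rewrite nbhs_simpl /=; apply: filterS => z /= hz.
apply: le_trans (h_le z); apply: le_trans hz.
have zE : z - graph x = col_mx (usubmx z - x) (dsubmx z - sigma x).
  by rewrite -[in LHS](vsubmxK z) opp_col_mx add_col_mx.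
have zN : enorm (usubmx z - x) <= enorm (z - graph x).
  rewrite zE -[X in enorm X <= _](col_mxKu _ (dsubmx z - sigma x)).
  exact: enorm_usubmx_le.
rewrite lee_fin zE dotv_col_mx dot0v addr0 -zE.
by rewrite lerD2l lerN2 ler_wpM2l// ltW.
Qed.

Lemma limiting_subdiff_graph x v :
  limiting_subdiff h x v -> limiting_subdiff H (graph x) (col_mx v 0).
Proof.
move=> [hx [x_ [v_ [xx hxx vv vvv]]]]; split; first by rewrite /edom/= sigma_min.
exists (graph \o x_), (fun k => col_mx (v_ k) 0); split.
- by apply: continuous_cvg => //; exact: continuous_graph.
- by rewrite sigma_min; under eq_fun do rewrite sigma_min.
- by move=> k; exact: regular_subdiff_graph.
- apply: (cvg_mx (F := \oo)) => i j.
  case: (split_ordP i) => k ->.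
    under eq_fun do rewrite col_mxEu.
    rewrite col_mxEu; apply: (cvg_comp v_ (fun M : 'cV[R]_n => M k j) vvv).
    exact: coord_continuous.
  under eq_fun do rewrite col_mxEd.
  by rewrite col_mxEd; exact: cvg_cst.
Qed.

(** Lifting [v] to [(v, 0)] does not change its norm. *)
Lemma dist0_graph x :
  (dist0 (limiting_subdiff H (graph x)) <= dist0 (limiting_subdiff h x))%E.
Proof.
apply: le_ereal_inf_tmp => _ [v hv <-]; apply: ereal_inf_lbound.
exists (col_mx v 0); first exact: limiting_subdiff_graph.
by rewrite enorm_col_mx0.
Qed.

(** The KL inequality of [H] is read along the graph: [H] and [h] take the same
    values there, and the distance factor of [h] is the larger one. *)
Lemma KL_at_graph alpha x : KL_at H alpha (graph x) -> KL_at h alpha x.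
Proof.
move=> [a [a0 [V [a_gt0 a0_gt0 xV HV]]]].
exists a, a0, (graph @^-1` V); split=> //; first exact: continuous_graph.
move=> y Vy; have := HV (graph y) Vy; rewrite !sigma_min => {}HV hxy hya.
have {}HV := HV hxy hya; apply: le_trans (HV) _.
apply: lee_wpmul2l; last exact: dist0_graph.
(* The derivative of the desingularizing function is nonnegative, since
   otherwise its product with a distance could not reach 1. *)
rewrite leNgt; apply/negP => d0; move: HV; apply/negP; rewrite -ltNge.
apply: le_lt_trans (lte01); rewrite mule_le0_ge0 ?dist0_ge0//.
exact: ltW.
Qed.

Lemma KL_function_partial_min alpha : proper_fun h -> lower_semicontinuous h ->
  KL_function H alpha -> KL_function h alpha.
Proof.
move=> hp hl [_ _ HKL]; split=> // x [v hv]; apply/KL_at_graph/HKL.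
by exists (col_mx v 0); exact: limiting_subdiff_graph.
Qed.

End PartialMinimization.

(** * Concave functions on the half-line *)

Section ConcaveHalfLine.
Context {R : realType} (phi : R -> R) (ell : R).
Hypothesis phi_cont : {within [set` `[0, +oo[], continuous phi}.
Hypothesis phi_concave : concave_on [set` `[0, +oo[] phi.
Hypothesis phi_diff : forall s, 0 < s -> derivable phi s 1.
Hypothesis phi_ell : derive1 phi s @[s --> 0^'+] --> ell.

(** On the half-line this is the derivative of [phi], extended to [0] by its
    limit there. *)
Definition slope (s : R) : R := if 0 < s then derive1 phi s else ell.

Lemma concave_chord (l s t : R) : 0 <= l -> l <= 1 -> 0 <= s -> 0 <= t ->
  l * phi s + (1 - l) * phi t <= phi (l * s + (1 - l) * t).
Proof.
move=> l0 l1 s0 t0.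
have := @phi_concave (Itv01 l0 l1) s t; rewrite !inE /= !in_itv /= !andbT.
move=> /(_ s0 t0); rewrite !convRE /= => H.
by rewrite -lerN2 opprD -!mulrN; exact: H.
Qed.

(** The difference quotients of [phi] at [y] in the direction [s - y] are bounded
    below by [phi s - phi y] for steps in [0, 1], hence so is their limit. *)
Lemma concave_tangent (y s : R) : 0 < y -> 0 <= s ->
  phi s <= phi y + derive1 phi y * (s - y).
Proof.
move=> y0 s0; rewrite -lerBlDl.
have dphi : differentiable phi y by apply/derivable1_diffP; exact: phi_diff.
have D : 'D_(s - y) phi y = derive1 phi y * (s - y).
  by rewrite deriveE// diff1E// mulrC.
rewrite -D.
have : derivable phi y (s - y) by exact: diff_derivable.
move/cvg_dnbhs_at_right/cvgr_to_ge; apply; near=> h.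
have h0 : 0 < h by near: h; exact: nbhs_right_gt.
have h1 : h <= 1 by near: h; exact: nbhs_right_le.
rewrite /= [_ *: _]mulrC ler_pdivlMr// lerBrDr mulrC.
have := concave_chord (ltW h0) h1 s0 (ltW y0).
have -> : h * s + (1 - h) * y = h *: (s - y) + y.
  by have -> : h *: (s - y) = h * (s - y) by []; ring.
by apply: le_trans; rewrite le_eqVlt; apply/orP; left; apply/eqP; ring.
Unshelve. all: by end_near. Qed.

Lemma slopeE (s : R) : 0 < s -> slope s = derive1 phi s.
Proof. by rewrite /slope => ->. Qed.

Lemma phi_cvg_within (y : R) : 0 <= y ->
  phi x @[x --> within [set` `[0, +oo[] (nbhs y)] --> phi y.
Proof.
move=> y0; have /subspace_continuousP := phi_cont; apply.
by rewrite /= in_itv /= y0.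
Qed.

(** At [y = 0] this is the limit of the tangent inequality at [t] as [t] decreases
    to [0], using that [phi] is continuous at the endpoint. *)
Lemma slope_supergradient (y s : R) : 0 <= y -> 0 <= s ->
  phi s <= phi y + slope y * (s - y).
Proof.
rewrite le_eqVlt => /predU1P[<-|y0] s0; last first.
  by rewrite slopeE// concave_tangent.
rewrite {1}/slope ltxx.
have c0 : phi x @[x --> 0^'+] --> phi 0.
  have := phi_cvg_within (lexx 0); apply: cvg_trans => A HA.
  apply: (filterS _ (HA : nbhs 0 _)) => x /= + x0; apply.
  by rewrite in_itv /= (ltW x0).
have : phi t + derive1 phi t * (s - t) @[t --> 0^'+] --> phi 0 + ell * (s - 0).
  apply: cvgD => //; apply: cvgM => //; apply: cvgB; first exact: cvg_cst.
  by apply: cvg_at_right_filter; exact: cvg_id.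
move/cvgr_to_ge; apply; near=> t.
by apply: concave_tangent => //; near: t; exact: nbhs_right_gt.
Unshelve. all: by end_near. Qed.

(** Adding the supergradient inequalities at [s] and [y] shows that [slope] is
    nonincreasing, and [ell] is its limit at [0]. *)
Lemma slope_le_ell (y : R) : 0 <= y -> slope y <= ell.
Proof.
rewrite le_eqVlt => /predU1P[<-|y0]; first by rewrite /slope ltxx.
move/cvgr_to_ge: phi_ell; apply; near=> s.
have s0 : 0 < s by near: s; exact: nbhs_right_gt.
have sy : s < y by near: s; exact: nbhs_right_lt.
have h1 := slope_supergradient (ltW s0) (ltW y0).
have h2 := slope_supergradient (ltW y0) (ltW s0).
rewrite -slopeE// -subr_ge0 -(pmulr_lge0 (x := y - s)) ?subr_gt0//.
nra.
Unshelve. all: by end_near. Qed.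

Lemma difference_quotient_cvg (y : R) : 0 < y ->
  h^-1 * (phi (h + y) - phi y) @[h --> 0^'] --> slope y.
Proof.
move=> y0; rewrite slopeE//.
have : derivable phi y 1 by exact: phi_diff.
rewrite derive1E /derivable /derive /=.
set q1 := fun h : R => h^-1 *: _; set q2 := fun h : R => h^-1 * _.
have -> // : q2 = q1.
by apply/funext => h; rewrite /q1 /q2 /= [h *: 1]mulr1.
Qed.

(** If a line of slope [c] through the graph at [y] passes below the graph at [s],
    then so does the parallel line through the graph at any [t] near [y]; the
    supergradient inequality at [t] then compares [slope t] with [c], in a sense
    that depends on the side of [t] on which [s] lies. *)
Lemma chord_above_near (y s c : R) : 0 < y -> 0 <= s ->
  phi y + c * (s - y) < phi s -> \forall t \near y, 0 < (slope t - c) * (s - t).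
Proof.
move=> y0 s0 cs.
have phiy : phi t @[t --> y] --> phi y.
  by apply: differentiable_continuous; apply/derivable1_diffP; exact: phi_diff.
have G : phi t + c * (s - t) @[t --> y] --> phi y + c * (s - y).
  apply: cvgD => //; apply: cvgM; first exact: cvg_cst.
  by apply: cvgB; [exact: cvg_cst|exact: cvg_id].
near=> t.
have t0 : 0 < t by near: t; exact: lt_nbhsr.
have Gt : phi t + c * (s - t) < phi s by near: t; exact: (cvgr_lt _ G).
have := slope_supergradient (ltW t0) s0; lra.
Unshelve. all: by end_near. Qed.

(** Differentiability at [y] provides a point on the right of [y] whose chord has
    slope above [slope y - e], and one on the left whose chord has slope below
    [slope y + e]; by [chord_above_near] they bound [slope t] on both sides. *)
Lemma slope_cvg (y : R) : 0 < y -> slope t @[t --> y] --> slope y.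
Proof.
move=> y0; have Q := difference_quotient_cvg y0.
apply/cvgrPdist_le => e e0.
have [s [sy s0 cs]] : exists s, [/\ y < s, 0 <= s &
    phi y + (slope y - e) * (s - y) < phi s].
  have : \forall h \near 0^'+, phi y + (slope y - e) * h < phi (h + y).
    have Q1 : \forall h \near 0^'+, slope y - e < h^-1 * (phi (h + y) - phi y).
      by apply: (cvgr_gt _ (cvg_dnbhs_at_right Q)); rewrite ltrBlDr ltrDl.
    near=> h; have h0 : 0 < h by near: h; exact: nbhs_right_gt.
    by rewrite -ltrBrDl -ltr_pdivlMr// mulrC; near: h.
  move=> /(filterI (nbhs_right_gt 0)) /filter_ex[h [h0 ch]].
  by exists (h + y); split; [rewrite ltrDr|rewrite addr_ge0 ?ltW|rewrite addrK].
have [s' [sy' s0' cs']] : exists s, [/\ s < y, 0 <= s &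
    phi y + (slope y + e) * (s - y) < phi s].
  have : \forall h \near 0^'-, phi y + (slope y + e) * h < phi (h + y).
    have Q1 : \forall h \near 0^'-, h^-1 * (phi (h + y) - phi y) < slope y + e.
      by apply: (cvgr_lt _ (cvg_dnbhs_at_left Q)); rewrite ltrDl.
    near=> h; have h0 : h < 0 by near: h; exact: nbhs_left_lt.
    by rewrite -ltrBrDl -ltr_ndivrMr// mulrC; near: h.
  (* The step is kept above - y, so that the point stays in the half-line. *)
  have y0' : - y < 0 by rewrite oppr_lt0.
  move=> /(filterI (nbhs_left_gt y0')) /(filterI (nbhs_left_lt 0)).
  move=> /filter_ex[h [h0 [hy ch]]].
  exists (h + y); split; [by rewrite gtrDr| |by rewrite addrK].
  by rewrite -lerBlDr sub0r ltW.
near=> t.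
have H1 : 0 < (slope t - (slope y - e)) * (s - t).
  by near: t; exact: chord_above_near.
have H2 : 0 < (slope t - (slope y + e)) * (s' - t).
  by near: t; exact: chord_above_near.
have ts : t < s by near: t; exact: lt_nbhsl.
have st : s' < t by near: t; exact: lt_nbhsr.
rewrite pmulr_lgt0 ?subr_gt0// in H1.
rewrite nmulr_lgt0 ?subr_lt0// in H2.
by rewrite ler_distl; apply/andP; split; lra.
Unshelve. all: by end_near. Qed.

Lemma slope_continuous : {within [set` `[0, +oo[], continuous slope}.
Proof.
apply/subspace_continuousP => y.
rewrite /from_subspace /= in_itv /= andbT le_eqVlt.
move=> /predU1P[<-|y0]; last first.
  by apply: cvg_within_filter; exact: slope_cvg.
move=> A slA.
have ellA : nbhs ell A by rewrite /slope ltxx in slA.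
have phiA := phi_ell ellA.
apply: (filterS _ (phiA : nbhs 0 _)) => s /= As.
rewrite in_itv /= andbT le_eqVlt => /predU1P[<-|s0].
  exact: (nbhs_singleton slA).
by rewrite /= slopeE//; exact: As.
Qed.

Lemma within_continuous_norm (g : R -> R) :
  {within [set` `[0, +oo[], continuous g} -> continuous (fun t : R => g `|t|).
Proof.
move=> /subspace_continuousP gc t A gA.
have := gc `|t|; rewrite /= in_itv /= normr_ge0 => /(_ isT _ gA) gA'.
have gA2 := @norm_continuous _ R t _ (gA' : nbhs _ _).
apply: (filterS _ (gA2 : nbhs t _)) => s /=; apply.
by rewrite in_itv /= normr_ge0.
Qed.

Lemma fenchel_young (g : R -> R) (w s : R) :
  ((w * s - g s)%:E <= fenchel_conj g w)%E.
Proof. by apply: ereal_sup_ubound; exists s. Qed.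

(** Equality holds in the Fenchel-Young inequality because [- slope y] is a
    subgradient of [psi] at [y].  For [s >= 0] this is
    [slope_supergradient].  For [s < 0], the supporting line is at most [0] at
    [0], hence at most [- slope y * s <= - ell * s <= psi s] at [s]. *)
Lemma fenchel_conj_slope (y : R) : phi 0 = 0 -> 0 <= y ->
  fenchel_conj (psi phi ell) (- slope y) = (phi y - slope y * y)%:E.
Proof.
move=> phi0 y0; apply/eqP; rewrite eq_le; apply/andP; split; last first.
  have := fenchel_young (psi phi ell) (- slope y) y.
  by rewrite /psi y0 mulNr opprK addrC.
apply: ge_ereal_sup => _ [s _ <-]; rewrite lee_fin /psi.
case: ifPn => [s0|]; first by have := slope_supergradient y0 s0; lra.
rewrite -ltNge => s0.
have h0 := slope_supergradient y0 (lexx 0).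
have hl := slope_le_ell y0.
rewrite phi0 in h0; nra.
Qed.

End ConcaveHalfLine.

Lemma sum_continuous {R : realType} {X : topologicalType} {I : finType}
    (f : I -> X -> R) :
  (forall i, continuous (f i)) -> continuous (fun x => \sum_i f i x).
Proof.
move=> fc x; apply: (cvg_big (op := +%R)); first exact: add_continuous.
by move=> i _; exact: fc.
Qed.

(** * The objective as a partial minimum *)

Section Objective.
Context {R : realType} {n p : nat} (Y : 'M[R]_(n, p)) (phi : R -> R) (ell : R).
Hypothesis phi_cont : {within [set` `[0, +oo[], continuous phi}.
Hypothesis phi_concave : concave_on [set` `[0, +oo[] phi.
Hypothesis phi0 : phi 0 = 0.
Hypothesis phi_diff : forall s, 0 < s -> derivable phi s 1.
Hypothesis phi_ell : derive1 phi s @[s --> 0^'+] --> ell.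

(** The minimizer of [Ftilde phi ell Y (col_mx x u)] over [u]. *)
Definition slopes (x : 'cV[R]_n) : 'cV[R]_p :=
  \col_i slope phi ell `|(Y^T *m x) i 0|.

Lemma F_obj_gt_ninfty x : (-oo < F_obj phi Y x)%E.
Proof. by rewrite /F_obj /indicator_fun; case: ifP => _ //=; rewrite ltNyr. Qed.

Lemma F_obj_le z : (F_obj phi Y (usubmx z) <= Ftilde phi ell Y z)%E.
Proof.
rewrite /F_obj /Ftilde /=; apply: leeD2r.
set x := usubmx z; set u := dsubmx z.
have -> : f_obj phi Y x =
    \sum_(i < p) (phi `|(Y^T *m x) i 0| - u i 0 * `|(Y^T *m x) i 0|)
    + dotv u (absv (Y^T *m x)).
  rewrite /f_obj /dotv -big_split /=; apply: eq_bigr => i _.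
  by rewrite [absv _ _ _]mxE subrK.
rewrite EFinD; apply: leeD2r; rewrite -sumEFin; apply: lee_sum => i _.
have := fenchel_young (psi phi ell) ((- u) i 0) `|(Y^T *m x) i 0|.
by rewrite /psi normr_ge0 opprK mxE mulNr addrC.
Qed.

Lemma Ftilde_slopes x : Ftilde phi ell Y (col_mx x (slopes x)) = F_obj phi Y x.
Proof.
rewrite /F_obj /Ftilde /= col_mxKu col_mxKd; congr (_ + _)%E.
rewrite /Psi_conj (eq_bigr (fun i => (phi `|(Y^T *m x) i 0|
    - slopes x i 0 * `|(Y^T *m x) i 0|)%:E)); last first.
  by move=> i _; rewrite !mxE fenchel_conj_slope.
rewrite sumEFin -EFinD; congr (_%:E).
rewrite /f_obj /dotv -big_split /=; apply: eq_bigr => i _.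
by rewrite [absv _ _ _]mxE subrK.
Qed.

Lemma continuous_mulmx_coord (i : 'I_p) :
  continuous (fun x : 'cV[R]_n => (Y^T *m x) i 0).
Proof.
have -> : (fun x : 'cV[R]_n => (Y^T *m x) i 0)
    = (fun x => \sum_j Y^T i j * x j 0) by apply/funext => y; rewrite mxE.
apply: sum_continuous => j x.
apply: (cvgM (F := nbhs x)); first exact: cvg_cst.
exact: coord_continuous.
Qed.

Lemma continuous_slopes : continuous slopes.
Proof.
move=> x; apply: (cvg_mx (F := nbhs x)) => i j.
have -> : (fun x => slopes x i j) =
    (fun x => slope phi ell `|(Y^T *m x) i 0|).
  by apply/funext => y; rewrite /slopes mxE.
rewrite [slopes x i j]mxE.
apply: (@continuous_comp _ _ _ (fun x : 'cV[R]_n => (Y^T *m x) i 0)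
  (fun t => slope phi ell `|t|)); first exact: continuous_mulmx_coord.
by apply: within_continuous_norm; exact: slope_continuous.
Qed.

Lemma continuous_f_obj : continuous (f_obj phi Y).
Proof.
apply: sum_continuous => i x.
apply: (@continuous_comp _ _ _ (fun x : 'cV[R]_n => (Y^T *m x) i 0)
  (fun t => phi `|t|)); first exact: continuous_mulmx_coord.
exact: within_continuous_norm.
Qed.

Lemma closed_unit_sphere : closed (@unit_sphere R n).
Proof.
have cdot : continuous (fun u : 'cV[R]_n => dotv u u).
  apply: sum_continuous.
  by move=> i u; apply: (cvgM (F := nbhs u)); exact: coord_continuous.
have -> : unit_sphere n = (fun u : 'cV[R]_n => dotv u u) @^-1` [set 1].
  apply/seteqP; split=> u; rewrite /unit_sphere /enorm /= => u1.
    by rewrite -(sqr_sqrtr (dotv_ge0 u)) u1 expr1n.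
  by rewrite u1 sqrtr1.
by apply: closed_comp => //; exact: closed_eq.
Qed.

Lemma F_obj_lsc : lower_semicontinuous (F_obj phi Y).
Proof.
move=> x a ax; have [xS|xS] := pselect (unit_sphere n x).
  have fx : a < f_obj phi Y x.
    by move: ax; rewrite /F_obj /indicator_fun mem_set// adde0 lte_fin.
  exists [set y | a < f_obj phi Y y].
    exact: (cvgr_gt _ (@continuous_f_obj x)).
  move=> y /= ay; rewrite /F_obj /indicator_fun; case: ifP => _.
    by rewrite adde0 lte_fin.
  by rewrite addey// ltry.
exists (~` unit_sphere n).
  by apply: open_nbhs_nbhs; split=> //; exact/closed_openC/closed_unit_sphere.
move=> y yS; rewrite /F_obj /indicator_fun memNset//.
by rewrite addey// ltry.
Qed.

Lemma F_obj_proper : proper_fun (Ftilde phi ell Y) -> proper_fun (F_obj phi Y).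
Proof.
move=> [_ [z zfin]]; split; first exact: F_obj_gt_ninfty.
exists (usubmx z); exact: le_lt_trans (F_obj_le z) zfin.
Qed.

End Objective.

Theorem theorem4p9 (R : realType) (n p : nat) (Y : 'M[R]_(n, p))
  (phi : R -> R) (ell alpha : R)
  (phi_ge0 : forall s, 0 <= s -> 0 <= phi s)
  (phi_cont : {within [set` `[0, +oo[], continuous phi})
  (phi_concave : concave_on [set` `[0, +oo[] phi)
  (phi0 : phi 0 = 0)
  (phi_diff : forall s, 0 < s -> derivable phi s 1)
  (phi_ell : derive1 phi s @[s --> 0^'+] --> ell)
  (alpha_range : 0 <= alpha < 1)
  (Ftilde_KL : KL_function (Ftilde phi ell Y) alpha) :
  KL_function (F_obj phi Y) alpha.
Proof.
have [Fproper _ _] := Ftilde_KL.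
apply: (@KL_function_partial_min _ _ _ _ _ (slopes Y phi ell)) Ftilde_KL.
- exact: F_obj_le.
- exact: Ftilde_slopes.
- exact: continuous_slopes.
- exact: F_obj_gt_ninfty.
- exact: F_obj_proper Fproper.
- exact: F_obj_lsc.
Qed.
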